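(* Let $(X,T)$ be a Tychonoff space (i.e. completely regular and Hausdorff). Then $\beta(X,T)=[({}^{*}X,{}^{S}T)]$; that is, the Hausdorff reflection $[({}^{*}X,{}^{S}T)]$ of $({}^{*}X,{}^{S}T)$, together with the map $\varphi\circ\eta_X:(X,T)\to[({}^{*}X,{}^{S}T)]$, is the Stone–Čech compactification of $(X,T)$, where $\eta_X:(X,T)\to({}^{*}X,{}^{S}T)$ is the inclusion map and $\varphi:({}^{*}X,{}^{S}T)\to[({}^{*}X,{}^{S}T)]$ is the reflection map.
   Context: Nonstandard setting: fix a nonstandard extension map $*$ on a superstructure containing all the sets under consideration, satisfying the transfer principle, with each $x\in X$ identified with ${}^{*}x$, so that $X\subseteq {}^{*}X$ and ${}^{*}A\cap X=A$ for all $A\subseteq X$. The extension is assumed to be an enlargement, saturated in the following sense: for every set $X$ under consideration and every family $\{F_i\}_{i\in I}$ of subsets of $X$ with the finite intersection property, there is $\alpha\in{}^{*}X$ with $\alpha\in{}^{*}F_i$ for all $i\in I$. For a topological space $(X,T)$, ${}^{S}T$ denotes the (standard) topology on ${}^{*}X$ with base $\{{}^{*}G : G\in T\}$. For a topological space $(Y,\tau)$, $[(Y,\tau)]$ denotes its $T_2$-reflection: a Hausdorff space together with a continuous map $\varphi:(Y,\tau)\to[(Y,\tau)]$ (the reflection map) such that every continuous map from $(Y,\tau)$ to a Hausdorff space factors uniquely through $\varphi$ by a continuous map. $\beta(X,T)$ denotes the Stone–Čech compactification of $(X,T)$. *)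

(* Defs.v *)
From HB Require Import structures.
From mathcomp Require Import all_boot.
From mathcomp Require Import boolp classical_sets cardinality.
From mathcomp Require Import topology urysohn.

Set Implicit Arguments.
Unset Strict Implicit.
Unset Printing Implicit Defensive.

Local Open Scope classical_set_scope.

(** * Superstructures

    The superstructure over [S] is the union of [V_0 = S] and
    [V_(n+1) = V_n `|` P(V_n)], with the elements of [S] as individuals:
    [stage n] is [V_n], every object lies in some [V_n], every subset of a [V_n]
    is an object, and sets are extensional.  This determines the structure up to
    a unique isomorphism over [S]. *)

Section Stages.
Variables (S obj : Type) (memb : obj -> obj -> Prop) (atom : S -> obj).

Definition is_set (a : obj) : Prop := ~ range atom a.

Fixpoint stage (n : nat) : set obj :=
  if n is m.+1
  then [set a | stage m a \/ (is_set a /\ forall x, memb x a -> stage m x)]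
  else range atom.

(* [a] is the set whose elements are those satisfying [P]; an individual does
   not represent the empty set, although nothing belongs to it. *)
Definition represents (a : obj) (P : set obj) : Prop :=
  is_set a /\ forall x, memb x a <-> P x.

End Stages.

Record superstructure (S : Type) := Superstructure {
  obj :> Type;
  memb : obj -> obj -> Prop;
  atom : S -> obj;
  atom_inj : injective atom;
  atom_empty : forall s x, ~ memb x (atom s);
  set_ext : forall a b, is_set atom a -> is_set atom b ->
    (forall x, memb x a <-> memb x b) -> a = b;
  stage_exhaust : forall a, exists n, stage memb atom n a;
  comprehension : forall n (P : set obj), P `<=` stage memb atom n ->
    exists a, represents memb atom a P
}.

Arguments memb {S _}.
Arguments atom {S _}.

(** * Bounded formulas

    First-order formulas in [=] and membership all of whose quantifiers are
    bounded.  Variables are de Bruijn indices; in [AllIn i p] and [ExIn i p] the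
    bound is the variable [i] outside the quantifier, and index 0 in [p] is the
    bound variable.  Parameters are supplied by the assignment. *)

Inductive bformula : Type :=
| Eq of nat & nat
| In of nat & nat
| Neg of bformula
| And of bformula & bformula
| Or of bformula & bformula
| Imp of bformula & bformula
| AllIn of nat & bformula
| ExIn of nat & bformula.

Definition push (T : Type) (x : T) (e : nat -> T) (n : nat) : T :=
  if n is m.+1 then e m else x.

Fixpoint sat (S : Type) (V : superstructure S) (e : nat -> V) (p : bformula) :
    Prop :=
  match p with
  | Eq i j => e i = e j
  | In i j => memb (e i) (e j)
  | Neg p => ~ sat e p
  | And p q => sat e p /\ sat e q
  | Or p q => sat e p \/ sat e q
  | Imp p q => sat e p -> sat e q
  | AllIn i p => forall x, memb x (e i) -> sat (push x e) p
  | ExIn i p => exists2 x, memb x (e i) & sat (push x e) p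
  end.

(** * Nonstandard extensions *)

(* [star_individuals] says that the target is the superstructure over the
   extension of the set of individuals. *)
Record nonstandard_extension (S S' : Type)
    (V : superstructure S) (W : superstructure S') := NonstandardExtension {
  star :> V -> W;
  star_individuals : forall a : V,
    represents memb atom a (range atom) ->
    represents memb atom (star a) (range atom);
  transfer : forall (p : bformula) (e : nat -> V),
    sat e p <-> sat (star \o e) p
}.

(* The case [D = set0] of the finite intersection property says that [a] has an
   element; without it the empty family of subsets of the empty set would be a
   counterexample. *)
Definition enlargement (S S' : Type) (V : superstructure S)
    (W : superstructure S') (E : nonstandard_extension V W) : Prop :=
  forall (a : V) (I : Type) (F : I -> V),
    is_set atom a ->
    (forall i, is_set atom (F i) /\ forall x, memb x (F i) -> memb x a) ->
    (forall D : set I, finite_set D ->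
      exists2 x, memb x a & forall i, D i -> memb x (F i)) ->
    exists2 y, memb y (E a) & forall i, memb y (E (F i)).

(** * The extension of a type *)

(* An identification of the type [X] with a set of the superstructure; the
   elements of that set need not be individuals. *)
Record realization (S : Type) (V : superstructure S) (X : Type) := Realization {
  name :> X -> V;
  name_inj : injective name;
  carrier : V;
  carrierP : represents memb atom carrier (range name)
}.

Section Code.
Variables (S : Type) (V : superstructure S) (X : Type) (r : realization V X).

Lemma code_subproof (A : set X) : exists a, represents memb atom a (r @` A).
Proof.
have [n stn] := stage_exhaust (carrier r).
have [cset cP] := carrierP r.
have {stn} : forall x, memb x (carrier r) -> stage memb atom n x.
  elim: n stn => [//|n IHn /= [/IHn h|[_ h]]] x xc; last by left; exact: h.
  by left; exact: h.
move=> h; apply: (@comprehension _ V n) => _ [x _ <-].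
by apply/h/cP; exists x.
Qed.

(* The subset [A] of [X] as an object of the superstructure. *)
Definition code (A : set X) : V := projT1 (cid (code_subproof A)).

Lemma codeP (A : set X) : represents memb atom (code A) (r @` A).
Proof. exact: (projT2 (cid (code_subproof A))). Qed.

End Code.

Section StarType.
Variables (S S' : Type) (V : superstructure S) (W : superstructure S').
Variables (E : nonstandard_extension V W) (X : Type) (r : realization V X).

Definition starT : Type := {y : W | memb y (E (carrier r))}.

HB.instance Definition _ := gen_eqMixin starT.
HB.instance Definition _ := gen_choiceMixin starT.

Definition star_set (A : set X) : set starT :=
  [set y | memb (proj1_sig y) (E (code r A))].

Lemma star_memb (x a : V) : memb x a <-> memb (E x) (E a).
Proof. exact: (transfer E (In 0 1) (push x (fun=> a))). Qed.

Lemma eta_subproof (x : X) : memb (E (r x)) (E (carrier r)).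
Proof. by apply/star_memb/(carrierP r).2; exists x. Qed.

(* The inclusion of [X] in its extension. *)
Definition eta (x : X) : starT := exist _ (E (r x)) (eta_subproof x).

Lemma star_setT : star_set setT = setT.
Proof.
apply/seteqP; split=> // -[y yc] _; rewrite /star_set /=.
have /= := (transfer E (AllIn 0 (In 0 2))
  (push (carrier r) (fun=> code r setT))).1.
apply=> // x /(carrierP r).2 [x' _ <-].
by apply/(codeP r setT).2; exists x'.
Qed.

Lemma star_setI (A B : set X) :
  star_set (A `&` B) = star_set A `&` star_set B.
Proof.
have cI x : memb x (code r (A `&` B)) <->
    memb x (code r A) /\ memb x (code r B).
  split=> [/(codeP r _).2[z [Az Bz] <-]|].
    by split; apply/(codeP r _).2; exists z.
  move=> [/(codeP r _).2[z Az <-] /(codeP r _).2[z' Bz zz']].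
  apply/(codeP r _).2; exists z => //; split => //.
  by rewrite -(name_inj zz').
pose e := push (code r (A `&` B)) (push (code r A) (fun=> code r B)).
apply/seteqP; split=> -[y yc]; rewrite /star_set /=.
  have /= := (transfer E (AllIn 0 (And (In 0 2) (In 0 3))) e).1.
  by apply=> // x /cI.
move=> [yA yB].
have /= := (transfer E (AllIn 1 (Imp (In 0 3) (In 0 1))) e).1.
by apply=> // x xA xB; apply/cI.
Qed.

End StarType.

Arguments star_set {S S' V W} E {X} r A.
Arguments eta {S S' V W} E {X} r x.

(** * The S-topology: the topology with base the extensions of the open sets *)

Section STopology.
Variables (S S' : Type) (V : superstructure S) (W : superstructure S').
Variables (E : nonstandard_extension V W).
Variables (X : topologicalType) (r : realization V X).

Let base_cover : \bigcup_(G in @open X) star_set E r G = setT.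
Proof.
rewrite -subTset => y _; exists setT; first exact: openT.
by rewrite star_setT.
Qed.

Let base_join (G H : set X) (y : starT E r) : open G -> open H ->
  star_set E r G y -> star_set E r H y ->
  exists K, [/\ open K, star_set E r K y &
    star_set E r K `<=` star_set E r G `&` star_set E r H].
Proof.
move=> oG oH Gy Hy; exists (G `&` H).
by rewrite star_setI; split=> //; exact: openI.
Qed.

HB.instance Definition _ := isBaseTopological.Build (starT E r)
  base_cover base_join.

End STopology.

(** * Hausdorff reflection and Stone-Cech compactification *)

(* The reflection is specified by its universal property, hence up to a unique
   homeomorphism under [Y]. *)
Definition T2_reflection (Y Z : topologicalType) (phi : Y -> Z) : Prop :=
  [/\ hausdorff_space Z, continuous phi &
    forall (H : topologicalType) (f : Y -> H),
      hausdorff_space H -> continuous f ->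
      exists! g : Z -> H, continuous g /\ g \o phi = f].

Definition embedding (X Y : topologicalType) (e : X -> Y) : Prop :=
  [/\ injective e, continuous e &
    forall U : set X, open U -> exists2 O : set Y, open O & U = e @^-1` O].

Definition compactification (X K : topologicalType) (e : X -> K) : Prop :=
  [/\ compact [set: K], hausdorff_space K, embedding e & dense (range e)].

Definition stone_cech_compactification (X K : topologicalType) (e : X -> K) :
    Prop :=
  compactification e /\
  forall (C : topologicalType) (f : X -> C),
    compact [set: C] -> hausdorff_space C -> continuous f ->
    exists! g : K -> C, continuous g /\ g \o e = f.

(* [completely_regular_space] separates points from closed sets by a uniformity
   coarser than the topology; by [uniform_separatorP] this is separation by a
   continuous function to [0, 1]. *)
Definition tychonoff_space (X : topologicalType) : Prop :=
  completely_regular_space X /\ hausdorff_space X.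

(* Main.v *)
Require Import Defs.
From mathcomp Require Import all_boot all_order all_algebra finmap.
From mathcomp Require Import boolp classical_sets functions cardinality.
From mathcomp Require Import reals topology normedtype Rstruct.

(** A point [y] of the extension of [X] is seen from [X] through the standard
    sets that it belongs to: the sets [A] whose extension contains [y]
    form an ultrafilter [standard_filter y] on [X] ([standard_filter_proper] and
    [star_setC]), whose open members give the basic S-neighborhoods of [y].  The
    enlargement property says that every proper filter on [X] is contained in
    such an ultrafilter ([standard_filter_realized]).  Three facts follow.

    - The extension is compact ([star_compact]): pull an ultrafilter on it back
      to a filter on [X]; a point realizing that filter is a limit.
    - [X] is dense in it ([eta_dense]), because a nonempty standard set has a
      standard element.
    - A continuous [f] from [X] into a compact subset of a regular Hausdorff
      space extends continuously to it ([star_extension]): send [y] to the limit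
      of [f] along [standard_filter y].  This is the standard part of the value
      at [y] of the nonstandard extension of [f].

    What the extension lacks is the Hausdorff property, and the reflection [phi]
    supplies it.  It is onto ([T2_reflection_surjective]), so its target is
    compact and contains the image of [X] as a dense subset.  Continuous maps to
    Hausdorff spaces factor through [phi], so maps from [X] to compact Hausdorff
    spaces, and to the unit interval, still extend; density makes the extension
    unique.  Finally, the extension of functions to the unit interval makes the
    map from [X] an embedding, because these functions separate the points of a
    Tychonoff space from its closed sets ([embedding_of_extensions]). *)

Set Implicit Arguments.
Unset Strict Implicit.
Unset Printing Implicit Defensive.

Import Order.TTheory Num.Theory numFieldTopology.Exports.

Local Open Scope classical_set_scope.

(** * Standard sets and the filter of a point of the extension *)

Section StarSets.
Variables (S S' : Type) (V : superstructure S) (W : superstructure S').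
Variables (E : nonstandard_extension V W) (X : Type) (r : realization V X).
Implicit Types (A B : set X) (y : starT E r).

Lemma star_set0 : star_set E r set0 = set0.
Proof.
apply/seteqP; split=> // -[y yc]; rewrite /star_set /=.
have /= := (transfer E (AllIn 0 (Neg (Eq 0 0))) (fun=> code r set0)).1.
move=> h yA; suff : ~ y = y by apply.
by apply: h yA => x /(codeP r set0).2 [].
Qed.

Lemma star_setS A B : A `<=` B -> star_set E r A `<=` star_set E r B.
Proof. by move=> /setIidPl <-; rewrite star_setI => y []. Qed.

Lemma star_setC A : star_set E r (~` A) = ~` star_set E r A.
Proof.
apply/seteqP; split=> [y CAy Ay|[y yc]].
  have : star_set E r (A `&` ~` A) y by rewrite star_setI; split.
  by rewrite setICr star_set0.
rewrite /star_set /= => nA.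
have /= total := (transfer E (AllIn 0 (Or (In 0 2) (In 0 3)))
  (push (carrier r) (push (code r A) (fun=> code r (~` A))))).1.
have [|//|//] := total _ y yc; move=> x /(carrierP r).2 [x' _ <-].
by have [Ax|Ax] := pselect (A x'); [left|right]; apply/(codeP r _).2; exists x'.
Qed.

Lemma star_set_eta A x : star_set E r A (eta E r x) <-> A x.
Proof.
rewrite /star_set /= -star_memb; split=> [|Ax].
  by case/(codeP r A).2 => x' Ax' /(name_inj (r:=r)) <-.
by apply/(codeP r A).2; exists x.
Qed.

Definition standard_filter y : set_system X := [set A | star_set E r A y].

Lemma standard_filter_proper y : ProperFilter (standard_filter y).
Proof.
apply: Build_ProperFilter_ex.
  move=> A Ay; apply/set0P/eqP => A0.
  by move: Ay; rewrite /standard_filter /= A0 star_set0.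
split; rewrite /standard_filter /=; first by rewrite star_setT.
- by move=> A B Ay By; rewrite /= star_setI.
- by move=> A B /star_setS; apply.
Qed.

(** The enlargement property in terms of filters: the finite intersection
    property of the family of all members of [F] is what makes [F] a proper
    filter. *)
Lemma standard_filter_realized (henl : enlargement E) (F : set_system X) :
  ProperFilter F -> exists y, F `<=` standard_filter y.
Proof.
move=> FF.
have [|i||y yX yF] := henl (carrier r) (set_type F) (fun i => code r (sval i)).
- exact: (carrierP r).1.
- split; first exact: (codeP r _).1.
  move=> x /(codeP r _).2 [x' _ <-]; apply/(carrierP r).2; by exists x'.
- move=> D /finite_fsetP [D' ->].
  have : F (\bigcap_(i in [set` D']) sval (i : set_type F)).
    by apply: filter_bigI => -[A FA] _; exact: set_mem FA.
  move=> /filter_ex [x xD]; exists (r x).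
    by apply/(carrierP r).2; exists x.
  by move=> i /xD ix; apply/(codeP r _).2; exists x.
exists (exist _ y yX) => A FA; exact: (yF (exist _ A (mem_set FA))).
Qed.

End StarSets.

(** * The S-topology *)

Section STopologyTheory.
Variables (S S' : Type) (V : superstructure S) (W : superstructure S').
Variables (E : nonstandard_extension V W).
Variables (X : topologicalType) (r : realization V X).

Lemma star_set_open (G : set X) : open G -> open (star_set E r G).
Proof.
by move=> oG; exists [set G]; [move=> _ ->|rewrite bigcup_set1].
Qed.

Lemma nbhs_starP (y : starT E r) (U : set (starT E r)) :
  nbhs y U <-> exists G, [/\ open G, star_set E r G y & star_set E r G `<=` U].
Proof.
rewrite nbhsE; split=> [[_ [[D oD <-] [G DG Gy]] DU]|[G [oG Gy GU]]].
  exists G; split=> //; first exact: oD.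
  by move=> z Gz; apply: DU; exists G.
by exists (star_set E r G) => //; split=> //; exact: star_set_open.
Qed.

Lemma eta_continuous : continuous (eta E r).
Proof.
move=> x U /nbhs_starP [G [oG /star_set_eta Gx GU]]; rewrite nbhs_simpl /=.
apply: (filterS (P := G)); last exact: open_nbhs_nbhs.
by move=> z /star_set_eta/GU.
Qed.

Lemma eta_dense : dense (range (eta E r)).
Proof.
move=> O [y Oy] oO.
have /nbhs_starP [G [_ Gy GO]] : nbhs y O by exact: open_nbhs_nbhs.
have [x Gx] := @filter_ex _ _ (standard_filter_proper y) _ Gy.
exists (eta E r x); split; last by exists x.
exact/GO/star_set_eta.
Qed.

(** The limit of an ultrafilter [U] is a point [y] realizing the filter of the
    standard sets that belong to [U].  If a basic neighborhood of [y] were not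
    in [U], its complement, again standard, would be, and [y] would lie in
    both. *)
Lemma star_compact (henl : enlargement E) : compact [set: starT E r].
Proof.
rewrite compact_ultra => U UU _.
have PU : ProperFilter U by exact: ultra_proper.
pose F : set_system X := [set A | U (star_set E r A)].
have FF : ProperFilter F.
  apply: Build_ProperFilter_ex.
    move=> A UA; have [y Ay] := @filter_ex _ U PU _ UA.
    exact: (@filter_ex _ _ (standard_filter_proper y) _ Ay).
  split; rewrite /F /=; first by rewrite star_setT; exact: filterT.
  - by move=> A B UA UB; rewrite /= star_setI; exact: filterI.
  - by move=> A B /star_setS AB; exact: filterS.
have [y Fy] := standard_filter_realized r henl FF.
exists y; split=> // O /nbhs_starP [G [_ Gy GO]]; apply: (filterS GO).
have [//|] := in_ultra_setVsetC (star_set E r G) UU.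
rewrite -star_setC => /Fy; rewrite /standard_filter /= star_setC.
by move/(_ Gy).
Qed.

(** Along the ultrafilter [standard_filter y], [f] has a cluster point in the
    compact set [K], and by [star_setC] a cluster point is a limit.  Regularity
    gives continuity of the limit: for an open [B'], at every
    point of the extension of the preimage of [B'] the limit lies in the closure
    of [B']. *)
Lemma star_extension (C : topologicalType) (K : set C) (f : X -> C) :
  hausdorff_space C -> regular_space C -> compact K -> range f `<=` K ->
  continuous f -> exists g : starT E r -> C, continuous g /\ g \o eta E r = f.
Proof.
move=> hC rC cK fK cf.
have cvgf (y : starT E r) : exists c : C, f @ standard_filter y --> c.
  have Fy := standard_filter_proper y.
  have /cK [|c [_ clc]] := fmap_proper_filter f Fy.
    apply: filterS (@filterT _ _ Fy) => x _; apply: fK; by exists x.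
  exists c => U Uc; apply: contrapT => nUy.
  have CUy : star_set E r (f @^-1` (~` U)) y by rewrite preimage_setC star_setC.
  by have [z []] := clc (~` U) U CUy Uc.
have [g gP] := choice cvgf.
exists g; split.
  move=> y U /rC [B]; rewrite nbhsE => -[B' [oB' B'y] B'B] BU.
  apply/nbhs_starP; exists (f @^-1` B'); split.
  - by move/continuousP: cf; apply.
  - by apply: (gP y); exact: open_nbhs_nbhs.
  move=> z B'z; apply/BU => A /gP Az.
  have Fz := standard_filter_proper z.
  have /filter_ex [x [Ax /B'B Bx]] := @filterI _ _ Fz _ _ Az B'z.
  by exists (f x).
apply/funext => x /=.
have Fx := standard_filter_proper (eta E r x).
apply: (@cvg_unique C hC _ (fmap_proper_filter f Fx) _ _ (gP _)) => U /cf Ux.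
exact/star_set_eta/(nbhs_singleton Ux).
Qed.

End STopologyTheory.

(** * Hausdorff reflections, density and embeddings *)

(** The corestriction of [phi] to its range [A] factors through [phi], by some
    [g].  Then [g] followed by the inclusion of [A] and the identity both factor
    [phi] through itself, so they agree by uniqueness, and every point lies in
    [A]. *)
Lemma T2_reflection_surjective (Y Z : topologicalType) (phi : Y -> Z) :
  T2_reflection phi -> range phi = setT.
Proof.
move=> [hZ cphi univ].
pose A := range phi.
pose p (y : Y) : A := exist _ (phi y) (mem_set (imageT phi y)).
have cval : continuous (set_val : A -> Z) by exact: initial_continuous.
have hA : hausdorff_space A.
  move=> a b clab; apply: val_inj; apply: hZ => U U' aU bU'.
  have [c [Uc U'c]] := clab _ _ (cval a U aU) (cval b U' bU').
  by exists (set_val c).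
have cp : continuous p.
  by apply/continuousP => _ [O oO <-]; move/continuousP: cphi => /(_ _ oO).
have [g [[cg gp] _]] := univ _ p hA cp.
have [i [_ iuniq]] := univ _ phi hZ cphi.
have e1 : i = id by apply: iuniq; split=> // z.
have e2 : i = set_val \o g.
  apply: iuniq; split; last by rewrite -compA gp.
  by move=> z; apply: continuous_comp; [exact: cg|exact: cval].
apply/seteqP; split=> // z _.
have -> : z = (set_val \o g) z by rewrite -e2 e1.
exact: set_valP.
Qed.

Lemma dense_eq (Y Z : topologicalType) (D : set Y) (f g : Y -> Z) :
  hausdorff_space Z -> dense D -> continuous f -> continuous g ->
  {in D, f =1 g} -> f = g.
Proof.
move=> hZ dD cf cg fg; apply/funext => y; apply: hZ => U U' Uy U'y.
have : nbhs y (f @^-1` U `&` g @^-1` U').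
  by apply: filterI; [exact: cf|exact: cg].
rewrite nbhsE => -[O [oO Oy] OUU].
have [z [Oz Dz]] := dD O (ex_intro _ y Oy) oO.
exists (f z); have [Uz U'z] := OUU z Oz; split=> //.
by rewrite (fg z (mem_set Dz)).
Qed.

Lemma dense_image (Y Z : topologicalType) (D : set Y) (f : Y -> Z) :
  continuous f -> range f = setT -> dense D -> dense (f @` D).
Proof.
move=> /continuousP cf sf dD O [z Oz] oO.
have [y _ fy] : range f z by rewrite sf.
have [|x [Ox Dx]] := dD (f @^-1` O) _ (cf _ oO).
  by exists y; rewrite /= fy.
by exists (f x); split=> //; exists x.
Qed.

(** Given [x] in an open [U], take a separating [f] that is 0 at [x] and 1 off
    [U]; where its extension is less than 1 is an open set of [Z] containing
    [e x] whose preimage is inside [U].  This gives the topology of [X] and,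
    [X] being Hausdorff, injectivity. *)
Lemma embedding_of_extensions (R : realType) (X Z : topologicalType)
    (e : X -> Z) :
  tychonoff_space X -> continuous e ->
  (forall f : X -> R, continuous f -> range f `<=` `[0%R, 1%R] ->
    exists g : Z -> R, continuous g /\ g \o e = f) ->
  embedding e.
Proof.
move=> [crX hX] ce ext.
have sep (U : set X) (x : X) : open U -> U x ->
    exists O : set Z, [/\ open O, O (e x) & e @^-1` O `<=` U].
  move=> oU Ux.
  have := crX x (~` U) (open_closedC oU) (fun nUx => nUx Ux).
  move=> /(uniform_separatorP (R := R)) [f [cf f01 f0 f1]].
  have [g [cg gf]] := ext f cf f01.
  have gE z : g (e z) = f z by rewrite -gf.
  exists (g @^-1` [set t | (t < 1)%R]); split.
  - by move/continuousP: cg; apply; exact: open_lt.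
  - by rewrite /= gE (f0 (f x)) ?ltr01 //; exists x.
  move=> z /=; rewrite gE => fz1; apply: contrapT => nUz.
  by move: fz1; rewrite (f1 (f z)) ?ltxx //; exists z.
split=> //.
  move=> x y exy; apply: hX => A B; rewrite nbhsE => -[U [oU Ux] UA] yB.
  have [O [_ Ox OU]] := sep U x oU Ux.
  exists y; split; last exact: nbhs_singleton.
  by apply/UA/OU; rewrite /= -exy.
move=> U oU.
exists (\bigcup_(O in [set O | open O /\ e @^-1` O `<=` U]) O).
  by apply: bigcup_open => O [].
apply/seteqP; split=> [x Ux|x [O [_ OU] Ox]]; last exact: OU.
by have [O [oO Ox OU]] := sep U x oU Ux; exists O.
Qed.

Theorem theorem4p2
    (S S' : Type) (V : superstructure S) (W : superstructure S')
    (E : nonstandard_extension V W) (henl : enlargement E)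
    (X : topologicalType) (r : realization V X) (hX : tychonoff_space X)
    (Z : topologicalType) (phi : starT E r -> Z) (hphi : T2_reflection phi) :
  stone_cech_compactification (phi \o eta E r).
Proof.
have [hZ cphi univ] := hphi.
have sphi := T2_reflection_surjective hphi.
have ce : continuous (phi \o eta E r).
  by move=> x; apply: continuous_comp; [exact: eta_continuous|exact: cphi].
have de : dense (range (phi \o eta E r)).
  have := dense_image cphi sphi (eta_dense (E:=E) (r:=r)).
  by rewrite image_comp.
have ext (C : topologicalType) (K : set C) (f : X -> C) :
    hausdorff_space C -> regular_space C -> compact K -> range f `<=` K ->
    continuous f ->
    exists g : Z -> C, continuous g /\ g \o (phi \o eta E r) = f.
  move=> hC rC cK fK cf.
  have [h [ch hf]] := star_extension E r hC rC cK fK cf.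
  have [g [[cg gh] _]] := univ _ h hC ch.
  by exists g; split=> //; rewrite compA gh.
split; last first.
  move=> C f cC hC cf.
  have rC : regular_space C.
    by move=> x; apply: (compact_regular hC cC); exact: filterT.
  have [|g [cg gf]] := ext C setT f hC rC cC _ cf; first by [].
  exists g; split=> // g' [cg' gf'].
  apply: (dense_eq hC de) => // z /set_mem [x _ <-].
  by have := congr1 (fun h => h x) gf'; rewrite -gf.
split=> //.
- rewrite -sphi; apply: continuous_compact; last exact: star_compact.
  exact: continuous_subspaceT.
apply: (@embedding_of_extensions Rdefinitions.R) => // f cf f01.
apply: (ext _ _ f _ _ _ f01 cf).
- exact: Rhausdorff.
- exact: uniform_regular.
- exact: segment_compact.
Qed.
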